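(* Let $C=g(w)$, $w=[u;v]$, be an $m\times n$ Cauchy matrix, $b\in\mathbb R^m$, and let $x_\lambda=(C^\top C+\lambda^2L^\top L)^{-1}C^\top b=P(C,\lambda)C^\top b$ be the solution of the Tikhonov regularization problem $\min_x\{\|Cx-b\|_2^2+\lambda^2\|Lx\|_2^2\}$. Assume $Mx_\lambda\ne0$ (and, for the formula for $c^{\mathsf{Reg}}_{\mathsf{Cauchy}}$, that every component of $Mx_\lambda$ is nonzero). Then the structured condition numbers are $$m^{\mathsf{Reg}}_{\mathsf{Cauchy}}(C,b)=\frac{\left\|\,|MP(C,\lambda)C_u||u|+|MP(C,\lambda)C_v||v|+|MP(C,\lambda)C^\top||b|\,\right\|_\infty}{\|Mx_\lambda\|_\infty},$$ $$c^{\mathsf{Reg}}_{\mathsf{Cauchy}}(C,b)=\left\|\frac{|MP(C,\lambda)C_u||u|+|MP(C,\lambda)C_v||v|+|MP(C,\lambda)C^\top||b|}{Mx_\lambda}\right\|_\infty,$$ $$\kappa^{\mathsf{Reg}}_{\mathsf{Cauchy}}(C,b)=\frac{\left\|MP(C,\lambda)\left[C_u,\ C_v,\ C^\top\right]\right\|_2\ \left\|\begin{bmatrix}w\\ b\end{bmatrix}\right\|_2}{\|Mx_\lambda\|_2}.$$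
   Context: Standing setting: $\lambda>0$ is fixed, $L\in\mathbb R^{p\times n}$ with $\mathrm{rank}(L)=p\le n\le m$, $\mathrm{rank}\begin{bmatrix}C\\ L\end{bmatrix}=n$, and $M\in\mathbb R^{l\times n}$ with $l\le n$. Put $P(C,\lambda)=(C^\top C+\lambda^2L^\top L)^{-1}$. For $u=[u_1,\dots,u_m]^\top\in\mathbb R^m$, $v=[v_1,\dots,v_n]^\top\in\mathbb R^n$ with $u_i\ne v_j$ for all $i,j$, and $w=[u;v]\in\mathbb R^{m+n}$, the Cauchy matrix $C=g(w)=[c_{ij}]\in\mathbb R^{m\times n}$ has entries $c_{ij}=\frac1{u_i-v_j}$. Define $$C_1=\left[\frac1{(u_i-v_j)^2}\right]\in\mathbb R^{m\times n},\quad r_\lambda=b-Cx_\lambda,\quad z_1=C_1x_\lambda,\quad z_2=C_1^\top r_\lambda,$$ $$C_u=C_1^\top\mathrm{Diag}(r_\lambda)-C^\top\mathrm{Diag}(z_1),\qquad C_v=C^\top C_1\mathrm{Diag}(x_\lambda)-\mathrm{Diag}(z_2),$$ where $\mathrm{Diag}(d)$ is the diagonal matrix with diagonal $d$. For perturbations $\Delta w\in\mathbb R^{m+n}$, $\Delta b\in\mathbb R^m$, let $\Delta C=g(w+\Delta w)-g(w)$ and $$\Delta x=\left[(C+\Delta C)^\top(C+\Delta C)+\lambda^2L^\top L\right]^{-1}(C+\Delta C)^\top(b+\Delta b)-x_\lambda .$$ The structured condition numbers are defined by $$m^{\mathsf{Reg}}_{\mathsf{Cauchy}}(C,b)=\lim_{\epsilon\to0}\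 \sup_{|\Delta w|\le\epsilon|w|,\ |\Delta b|\le\epsilon|b|}\frac{\|M\Delta x\|_\infty}{\epsilon\|Mx_\lambda\|_\infty},\qquad c^{\mathsf{Reg}}_{\mathsf{Cauchy}}(C,b)=\lim_{\epsilon\to0}\ \sup_{|\Delta w|\le\epsilon|w|,\ |\Delta b|\le\epsilon|b|}\frac1\epsilon\left\|\frac{M\Delta x}{Mx_\lambda}\right\|_\infty,$$ $$\kappa^{\mathsf{Reg}}_{\mathsf{Cauchy}}(C,b)=\lim_{\epsilon\to0}\ \sup_{\|[\Delta w;\Delta b]\|_2\le\epsilon\|[w;b]\|_2}\frac{\|M\Delta x\|_2}{\epsilon\|Mx_\lambda\|_2},$$ with $\epsilon\to0$ through positive values. Here $|\cdot|$ and $\le$ on vectors and matrices are entrywise, the quotient of two vectors is componentwise, $[x;y]$ stacks $x$ on top of $y$, and $\|\cdot\|_2$ of a matrix is the spectral norm. *)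

(* Defs.v *)
From HB Require Import structures.
From mathcomp Require Import all_boot all_order all_algebra.
From mathcomp Require Import all_classical all_reals all_analysis.
From mathcomp Require Import ring.

Set Implicit Arguments.
Unset Strict Implicit.
Unset Printing Implicit Defensive.

Import Order.TTheory GRing.Theory Num.Theory.
Import numFieldNormedType.Exports.

Local Open Scope classical_set_scope.
Local Open Scope ring_scope.

(* The infinity norm of a column vector is the library norm `|x| on
   'cV[R]_k (mx_norm, the largest absolute value of an entry). *)

Definition norm2 (R : realType) (k : nat) (x : 'cV[R]_k) : R :=
  Num.sqrt (\sum_i x i 0 ^+ 2).

(* The operator norm induced by norm2; the set is nonempty and bounded. *)
Definition spectral_norm (R : realType) (k q : nat) (A : 'M[R]_(k, q)) : R :=
  sup [set norm2 (A *m x) | x in [set x : 'cV[R]_q | norm2 x <= 1]].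

Definition absmx (R : realType) (k q : nat) (A : 'M[R]_(k, q)) : 'M[R]_(k, q) :=
  map_mx Num.norm A.

Definition lemx (R : realType) (k q : nat) (A B : 'M[R]_(k, q)) : Prop :=
  forall i j, A i j <= B i j.

Definition cdiv (R : realType) (k : nat) (x y : 'cV[R]_k) : 'cV[R]_k :=
  \col_i (x i 0 / y i 0).

Definition Diag (R : realType) (k : nat) (d : 'cV[R]_k) : 'M[R]_k :=
  diag_mx d^T.

Definition tikP (R : realType) (m n p : nat) (lambda : R) (L : 'M[R]_(p, n))
    (C : 'M[R]_(m, n)) : 'M[R]_n :=
  invmx (C^T *m C + lambda ^+ 2 *: (L^T *m L)).

Definition tiksol (R : realType) (m n p : nat) (lambda : R) (L : 'M[R]_(p, n))
    (C : 'M[R]_(m, n)) (b : 'cV[R]_m) : 'cV[R]_n :=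
  tikP lambda L C *m C^T *m b.

Definition tikobj (R : realType) (m n p : nat) (lambda : R) (L : 'M[R]_(p, n))
    (C : 'M[R]_(m, n)) (b : 'cV[R]_m) (x : 'cV[R]_n) : R :=
  norm2 (C *m x - b) ^+ 2 + lambda ^+ 2 * norm2 (L *m x) ^+ 2.

Definition cauchy_mx (R : realType) (m n : nat) (w : 'cV[R]_(m + n)) :
    'M[R]_(m, n) :=
  \matrix_(i, j) (usubmx w i 0 - dsubmx w j 0)^-1.

Definition cauchy_sq_mx (R : realType) (m n : nat) (w : 'cV[R]_(m + n)) :
    'M[R]_(m, n) :=
  \matrix_(i, j) ((usubmx w i 0 - dsubmx w j 0) ^+ 2)^-1.

Definition Cu (R : realType) (m n p : nat) (lambda : R) (L : 'M[R]_(p, n))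
    (w : 'cV[R]_(m + n)) (b : 'cV[R]_m) : 'M[R]_(n, m) :=
  let C := cauchy_mx w in
  let C1 := cauchy_sq_mx w in
  let x := tiksol lambda L C b in
  let r := b - C *m x in
  let z1 := C1 *m x in
  C1^T *m Diag r - C^T *m Diag z1.

Definition Cv (R : realType) (m n p : nat) (lambda : R) (L : 'M[R]_(p, n))
    (w : 'cV[R]_(m + n)) (b : 'cV[R]_m) : 'M[R]_n :=
  let C := cauchy_mx w in
  let C1 := cauchy_sq_mx w in
  let x := tiksol lambda L C b in
  let r := b - C *m x in
  let z2 := C1^T *m r in
  C^T *m C1 *m Diag x - Diag z2.

Definition deltax (R : realType) (m n p : nat) (lambda : R) (L : 'M[R]_(p, n))
    (w : 'cV[R]_(m + n)) (b : 'cV[R]_m)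
    (dw : 'cV[R]_(m + n)) (db : 'cV[R]_m) : 'cV[R]_n :=
  let C := cauchy_mx w in
  let dC := cauchy_mx (w + dw) - cauchy_mx w in
  tiksol lambda L (C + dC) (b + db) - tiksol lambda L C b.

(* When eps is large a perturbation may make some u_i + du_i equal to
   v_j + dv_j, or the regularized normal matrix singular; the total inverses
   then return arbitrary values. This cannot happen for eps small enough, so the
   limits at 0^'+ below do not depend on it. The suprema are taken in \bar R. *)

Definition cw_perturb (R : realType) (m n : nat)
    (w : 'cV[R]_(m + n)) (b : 'cV[R]_m) (eps : R) :
    set ('cV[R]_(m + n) * 'cV[R]_m) :=
  [set d | lemx (absmx d.1) (eps *: absmx w) /\
           lemx (absmx d.2) (eps *: absmx b)].

Definition nw_perturb (R : realType) (m n : nat)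
    (w : 'cV[R]_(m + n)) (b : 'cV[R]_m) (eps : R) :
    set ('cV[R]_(m + n) * 'cV[R]_m) :=
  [set d | norm2 (col_mx d.1 d.2) <= eps * norm2 (col_mx w b)].

Definition mReg_sup (R : realType) (m n p l : nat) (lambda : R)
    (L : 'M[R]_(p, n)) (M : 'M[R]_(l, n)) (w : 'cV[R]_(m + n)) (b : 'cV[R]_m)
    (eps : R) : \bar R :=
  let x := tiksol lambda L (cauchy_mx w) b in
  ereal_sup [set (`|M *m deltax lambda L w b d.1 d.2|
                    / (eps * `|M *m x|))%:E
            | d in cw_perturb w b eps].

Definition cReg_sup (R : realType) (m n p l : nat) (lambda : R)
    (L : 'M[R]_(p, n)) (M : 'M[R]_(l, n)) (w : 'cV[R]_(m + n)) (b : 'cV[R]_m)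
    (eps : R) : \bar R :=
  let x := tiksol lambda L (cauchy_mx w) b in
  ereal_sup [set (eps^-1
                    * `|cdiv (M *m deltax lambda L w b d.1 d.2) (M *m x)|)%:E
            | d in cw_perturb w b eps].

Definition kappaReg_sup (R : realType) (m n p l : nat) (lambda : R)
    (L : 'M[R]_(p, n)) (M : 'M[R]_(l, n)) (w : 'cV[R]_(m + n)) (b : 'cV[R]_m)
    (eps : R) : \bar R :=
  let x := tiksol lambda L (cauchy_mx w) b in
  ereal_sup [set (norm2 (M *m deltax lambda L w b d.1 d.2)
                    / (eps * norm2 (M *m x)))%:E
            | d in nw_perturb w b eps].

Definition mReg (R : realType) (m n p l : nat) (lambda : R)
    (L : 'M[R]_(p, n)) (M : 'M[R]_(l, n)) (w : 'cV[R]_(m + n)) (b : 'cV[R]_m) :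
    \bar R :=
  lim (mReg_sup lambda L M w b eps @[eps --> 0^'+]).

Definition cReg (R : realType) (m n p l : nat) (lambda : R)
    (L : 'M[R]_(p, n)) (M : 'M[R]_(l, n)) (w : 'cV[R]_(m + n)) (b : 'cV[R]_m) :
    \bar R :=
  lim (cReg_sup lambda L M w b eps @[eps --> 0^'+]).

Definition kappaReg (R : realType) (m n p l : nat) (lambda : R)
    (L : 'M[R]_(p, n)) (M : 'M[R]_(l, n)) (w : 'cV[R]_(m + n)) (b : 'cV[R]_m) :
    \bar R :=
  lim (kappaReg_sup lambda L M w b eps @[eps --> 0^'+]).

Lemma norm2_sqr (R : realType) (k : nat) (x : 'cV[R]_k) :
  norm2 x ^+ 2 = (x^T *m x) 0 0.
Proof.
rewrite sqr_sqrtr; last by apply: sumr_ge0 => i _; rewrite sqr_ge0.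
by rewrite mxE; apply: eq_bigr => i _; rewrite mxE expr2.
Qed.

Lemma norm2_eq0 (R : realType) (k : nat) (x : 'cV[R]_k) :
  norm2 x ^+ 2 = 0 -> x = 0.
Proof.
rewrite sqr_sqrtr => [|]; last by apply: sumr_ge0 => i _; rewrite sqr_ge0.
move=> /psumr_eq0P x0; apply/colP => i; rewrite mxE.
by apply/eqP; rewrite -sqrf_eq0 x0// => j _; rewrite sqr_ge0.
Qed.

Lemma tik_defpos (R : realType) (m n p : nat) (lambda : R)
    (L : 'M[R]_(p, n)) (C : 'M[R]_(m, n)) (h : 'cV[R]_n) :
  0 < lambda -> \rank (col_mx C L) = n ->
  norm2 (C *m h) ^+ 2 + lambda ^+ 2 * norm2 (L *m h) ^+ 2 = 0 -> h = 0.
Proof.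
move=> l0 rk /eqP.
have l2 : 0 < lambda ^+ 2 by rewrite exprn_gt0.
rewrite paddr_eq0; [|exact: sqr_ge0|by rewrite mulr_ge0 ?sqr_ge0].
move=> /andP[/eqP/norm2_eq0 Ch].
rewrite [_ * _ == 0]mulf_eq0 (gt_eqF l2) => /eqP/norm2_eq0 Lh.
have rf : row_free (col_mx C L)^T by rewrite /row_free mxrank_tr rk.
apply: trmx_inj; apply: (row_free_inj rf).
by rewrite -trmx_mul mul_col_mx Ch Lh col_mx0 !trmx0 mul0mx.
Qed.

Lemma tik_unitmx (R : realType) (m n p : nat) (lambda : R)
    (L : 'M[R]_(p, n)) (C : 'M[R]_(m, n)) :
  0 < lambda -> \rank (col_mx C L) = n ->
  C^T *m C + lambda ^+ 2 *: (L^T *m L) \in unitmx.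
Proof.
move=> l0 rk; rewrite -row_free_unit; apply: inj_row_free => v vA.
apply: trmx_inj; rewrite trmx0; apply: (tik_defpos l0 rk).
have : (v *m (C^T *m C + lambda ^+ 2 *: (L^T *m L)) *m v^T) 0 0 = 0.
  by rewrite vA mul0mx mxE.
rewrite mulmxDr mulmxDl -scalemxAr -scalemxAl mxE [X in _ + X]mxE => <-.
by rewrite !norm2_sqr !trmx_mul !trmxK !mulmxA.
Qed.

Lemma tiksol_argmin (R : realType) (m n p : nat) (lambda : R)
    (L : 'M[R]_(p, n)) (C : 'M[R]_(m, n)) (b : 'cV[R]_m) (x : 'cV[R]_n) :
  0 < lambda -> \rank (col_mx C L) = n ->
  (forall y, tikobj lambda L C b x <= tikobj lambda L C b y) <->
  x = tiksol lambda L C b.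
Proof.
move=> l0 rk; set s := tiksol _ _ _ _.
have addE (X Y : 'M[R]_1) : (X + Y) 0 0 = X 0 0 + Y 0 0 by rewrite mxE.
have objE h : tikobj lambda L C b (s + h) = tikobj lambda L C b s +
    (norm2 (C *m h) ^+ 2 + lambda ^+ 2 * norm2 (L *m h) ^+ 2).
  have hs : (h^T *m ((C^T *m C + lambda ^+ 2 *: (L^T *m L)) *m s)) 0 0
      = (h^T *m (C^T *m b)) 0 0.
    by rewrite /s /tiksol /tikP -(mulmxA _ C^T b) mulKVmx ?tik_unitmx.
  have nD k (a c : 'cV[R]_k) : norm2 (a + c) ^+ 2 =
      norm2 a ^+ 2 + norm2 c ^+ 2 + 2 * (c^T *m a) 0 0.
    rewrite !norm2_sqr [(a + c)^T]raddfD /= mulmxDr !mulmxDl !addE.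
    have -> : (a^T *m c) 0 0 = (c^T *m a) 0 0.
      by rewrite -[a^T *m c]trmxK trmx_mul trmxK mxE.
    by ring.
  rewrite /tikobj !mulmxDr addrAC !nD.
  have cross : ((C *m h)^T *m (C *m s - b)) 0 0
      + lambda ^+ 2 * ((L *m h)^T *m (L *m s)) 0 0 = 0.
    have -> : ((C *m h)^T *m (C *m s - b)) 0 0
        + lambda ^+ 2 * ((L *m h)^T *m (L *m s)) 0 0
        = (h^T *m ((C^T *m C + lambda ^+ 2 *: (L^T *m L)) *m s)
           - h^T *m (C^T *m b)) 0 0.
      rewrite !trmx_mul mulmxBr mulmxDl mulmxDr -scalemxAl -scalemxAr !mulmxA.
      by rewrite !mxE addrAC.
    by rewrite mxE hs [X in _ + X]mxE subrr.
  by move/eqP: cross; rewrite addr_eq0 => /eqP cross; ring: cross.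
split=> [xmin|-> y].
  have := xmin s; rewrite -[in X in X <= _](subrKC s x) objE.
  rewrite gerDl => le0; apply/eqP; rewrite -subr_eq0; apply/eqP.
  apply: (tik_defpos l0 rk); apply/eqP; rewrite eq_le le0/=.
  by apply: addr_ge0; [exact: sqr_ge0|apply: mulr_ge0; exact: sqr_ge0].
rewrite -(subrKC s y) objE lerDl.
by apply: addr_ge0; [exact: sqr_ge0|apply: mulr_ge0; exact: sqr_ge0].
Qed.

(* Main.v *)
Require Import Defs.
From mathcomp Require Import all_boot all_order all_algebra.
From mathcomp Require Import all_classical all_reals all_analysis.
From mathcomp Require Import ring lra.
Import Order.TTheory GRing.Theory Num.Theory.
Import numFieldNormedType.Exports.
Local Open Scope classical_set_scope.
Local Open Scope ring_scope.

(** The solution [x] of the regularized problem is a differentiable function of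
    the data [(w, b)], and each condition number is the corresponding norm of
    its derivative, rescaled by the data.

    Derivative. If [y] is the change of the solution caused by the change
    [(dC, db)] of [(C, b)], the perturbed normal equations read
    [(A + E) y = h], where [A] and [A + E] are the unperturbed and perturbed
    normal matrices and [h] is the residual of the perturbed equations at [x].
    Since [A] is invertible, so is [A + E] near [A], with bounded inverse; hence
    [y] is of first order, [y = A^-1 h - A^-1 E y], and the last term is of
    second order ([ord_tiksol]). The entries of [C] are inverses of
    [u_i - v_j], so [dC] agrees up to second order with
    [C_1 Diag(dv) - Diag(du) C_1] ([ord_cauchy_mx]). Composing the two
    expansions, [M y] agrees up to second order with [J [dw; db]], where
    [J = M P [- C_u, - C_v, C^T]] ([ord_cauchy_deltax]).

    Suprema. The admissible perturbations shrink linearly with [eps], so the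
    second-order error disappears in the limit, and it suffices to compute the
    suprema for the linear map [J] ([cvg_ereal_sup_scaled]). For componentwise
    perturbations each component [i] of [J h] is maximal when the signs of [h]
    match row [i] of [J], with value the [i]-th component of [|J| |[w; b]|];
    a diagonal weight yields the mixed and the componentwise numbers at once
    ([cvg_componentwise]). For normwise perturbations the supremum is the
    spectral norm of [J] times the norm of the data ([cvg_normwise]). The signs
    of the blocks [C_u] and [C_v] change neither [|J|] nor the spectral norm. *)

Set Implicit Arguments.
Unset Strict Implicit.
Unset Printing Implicit Defensive.

(** * Entrywise maximum norm of matrices *)

Section MatrixNorm.
Context {R : realType}.

Lemma mx_norm_ge p q (A : 'M[R]_(p, q)) i j : `|A i j| <= `|A|.
Proof.
rewrite [leRHS]/Num.norm /= mx_normrE.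
by apply/bigmax_geP; right => /=; exists (i, j).
Qed.

Lemma mx_norm_le p q (A : 'M[R]_(p, q)) (c : R) :
  0 <= c -> (forall i j, `|A i j| <= c) -> `|A| <= c.
Proof.
move=> c0 Ac; rewrite [leLHS]/Num.norm /= mx_normrE.
by apply/bigmax_leP; split => // -[i j] _; exact: Ac.
Qed.

Lemma mx_norm_mono p q (A B : 'M[R]_(p, q)) :
  (forall i j, `|A i j| <= `|B i j|) -> `|A| <= `|B|.
Proof.
by move=> AB; apply: mx_norm_le => // i j; exact: le_trans (mx_norm_ge B i j).
Qed.

Lemma mx_norm_entry p q (A : 'M[R]_(p, q)) :
  A != 0 -> exists i j, `|A| = `|A i j|.
Proof.
by rewrite -normr_eq0 => /mx_norm_neq0[[i j] ?]; exists i, j.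
Qed.

Lemma mx_norm_tr p q (A : 'M[R]_(p, q)) : `|A^T| = `|A|.
Proof.
apply/eqP; rewrite eq_le; apply/andP; split; apply: mx_norm_le => // i j.
  by rewrite mxE mx_norm_ge.
by rewrite -[A]trmxK mxE trmxK mx_norm_ge.
Qed.

Lemma mx_norm_mul p q s (A : 'M[R]_(p, q)) (B : 'M[R]_(q, s)) :
  `|A *m B| <= q%:R * (`|A| * `|B|).
Proof.
apply: mx_norm_le => [|i j]; first by rewrite !mulr_ge0.
rewrite mxE (le_trans (ler_norm_sum _ _ _)) //.
have -> : q%:R * (`|A| * `|B|) = \sum_(k < q) `|A| * `|B|.
  by rewrite sumr_const card_ord mulr_natl.
by apply: ler_sum => k _; rewrite normrM ler_pM // mx_norm_ge.
Qed.

End MatrixNorm.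

(** * Order of vanishing at the origin *)

(** [ord k f]: [f d] is O(|d|^k) as [d] tends to 0. In particular [ord 0 f] says
    that [f] is bounded near 0. *)
Definition ord (R : realType) (V : normedModType R) (W : normedZmodType R)
    (k : nat) (f : V -> W) : Prop :=
  exists2 K : R, 0 <= K & \forall d \near (0 : V), `|f d| <= K * `|d| ^+ k.

Section Order.
Context {R : realType} {V : normedModType R}.

Lemma near0_norm_le (e : R) : 0 < e -> \forall d \near (0 : V), `|d| <= e.
Proof. by move=> e0; exact: nbhs0_le. Qed.

Lemma ord_near (W : normedZmodType R) k (f g : V -> W) :
  (\forall d \near (0 : V), f d = g d) -> ord k f -> ord k g.
Proof.
move=> fg [K K0 Kf]; exists K => //.
by near=> d; rewrite -(near fg d)//; near: d.
Unshelve. all: by end_near. Qed.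

Lemma ordW (W : normedZmodType R) j k (f : V -> W) :
  (j <= k)%N -> ord k f -> ord j f.
Proof.
move=> jk [K K0 Kf]; exists K => //; near=> d.
apply: (le_trans (near Kf d _)) => //; rewrite ler_wpM2l //.
by rewrite ler_wiXn2l //; near: d; exact: near0_norm_le.
Unshelve. all: by end_near. Qed.

Lemma ordD (W : normedZmodType R) k (f g : V -> W) :
  ord k f -> ord k g -> ord k (fun d => f d + g d).
Proof.
move=> [K K0 Kf] [H H0 Hg]; exists (K + H); first exact: addr_ge0.
near=> d; rewrite mulrDl (le_trans (ler_normD _ _)) // lerD //.
  by near: d.
by near: d.
Unshelve. all: by end_near. Qed.

Lemma ordN (W : normedZmodType R) k (f : V -> W) :
  ord k f -> ord k (fun d => - f d).
Proof.
by move=> [K K0 Kf]; exists K => //; near=> d; rewrite normrN; near: d.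
Unshelve. all: by end_near. Qed.

Lemma ordB (W : normedZmodType R) k (f g : V -> W) :
  ord k f -> ord k g -> ord k (fun d => f d - g d).
Proof. by move=> ? ?; apply: ordD => //; exact: ordN. Qed.

Lemma ord_cst (W : normedZmodType R) (a : W) : ord 0 (fun _ : V => a).
Proof. by exists `|a| => //; near=> d; rewrite expr0 mulr1.
Unshelve. all: by end_near. Qed.

Lemma ord_tr p q k (f : V -> 'M[R]_(p, q)) :
  ord k f -> ord k (fun d => (f d)^T).
Proof.
by move=> [K K0 Kf]; exists K => //; near=> d; rewrite mx_norm_tr; near: d.
Unshelve. all: by end_near. Qed.

Lemma ord_mul p q s j k (f : V -> 'M[R]_(p, q)) (g : V -> 'M[R]_(q, s)) :
  ord j f -> ord k g -> ord (j + k) (fun d => f d *m g d).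
Proof.
move=> [K K0 Kf] [H H0 Hg]; exists (q%:R * (K * H)); first by rewrite !mulr_ge0.
near=> d; apply: (le_trans (mx_norm_mul _ _)).
rewrite -mulrA ler_wpM2l // exprD mulrACA ler_pM //.
  by near: d.
by near: d.
Unshelve. all: by end_near. Qed.

Lemma ord_mull p q s k (A : 'M[R]_(p, q)) (g : V -> 'M[R]_(q, s)) :
  ord k g -> ord k (fun d => A *m g d).
Proof. by move=> gk; exact: (ord_mul (ord_cst A) gk). Qed.

Lemma ord_mulr p q s k (f : V -> 'M[R]_(p, q)) (B : 'M[R]_(q, s)) :
  ord k f -> ord k (fun d => f d *m B).
Proof. by move=> fk; rewrite -[k]addn0; exact: (ord_mul fk (ord_cst B)). Qed.

Lemma ord_mx p q k (f : V -> 'M[R]_(p, q)) :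
  (forall i j, ord k (fun d => f d i j)) -> ord k f.
Proof.
move=> fk.
have /choice[K KP] : forall ij : 'I_p * 'I_q, exists K : R,
    0 <= K /\ \forall d \near (0 : V), `|f d ij.1 ij.2| <= K * `|d| ^+ k.
  by move=> [i j]; have [K K0 ?] := fk i j; exists K.
have K0 ij : 0 <= K ij by have [] := KP ij.
exists (\sum_ij K ij); first exact: sumr_ge0.
have fK : \forall d \near (0 : V), forall ij,
    `|f d ij.1 ij.2| <= K ij * `|d| ^+ k.
  by apply: filter_forall => ij; exact: (KP ij).2.
near=> d; apply: mx_norm_le => [|i j]; first by rewrite mulr_ge0 ?sumr_ge0.
have /(_ (i, j)) fKd : forall ij, `|f d ij.1 ij.2| <= K ij * `|d| ^+ k.
  by near: d.
apply: (le_trans fKd).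
by rewrite ler_wpM2r ?exprn_ge0 // (bigD1 (i, j)) //= lerDl sumr_ge0.
Unshelve. all: by end_near. Qed.

Lemma ord1_near_le (W : normedZmodType R) (f : V -> W) (e : R) :
  0 < e -> ord 1 f -> \forall d \near (0 : V), `|f d| <= e.
Proof.
move=> e0 [K K0 Kf]; have K1 : 0 < K + 1 by rewrite ltr_wpDl.
near=> d; apply: (le_trans (near Kf d _)) => //; rewrite expr1.
apply: (@le_trans _ _ ((K + 1) * `|d|)); first by rewrite ler_wpM2r // lerDl.
rewrite mulrC -ler_pdivlMr //; near: d.
by apply: near0_norm_le; exact: divr_gt0.
Unshelve. all: by end_near. Qed.

(** The second-order expansion of the inverse of a scalar [a + t]. *)
Lemma ord_inv (a : R) (t : V -> R) : a != 0 -> ord 1 t ->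
  ord 2 (fun d => (a + t d)^-1 - a^-1 + t d / a ^+ 2).
Proof.
move=> a0 t1; have a_gt0 : 0 < `|a| by rewrite normr_gt0.
have ta : \forall d \near (0 : V), `|t d| <= `|a| / 2.
  by apply: ord1_near_le => //; rewrite divr_gt0.
have [K K0 Kt] := t1.
exists (2 * K ^+ 2 / `|a| ^+ 3).
  by rewrite divr_ge0 ?mulr_ge0 ?exprn_ge0.
near=> d.
have td : `|t d| <= `|a| / 2 by near: d.
have atd : `|a| / 2 <= `|a + t d|.
  have := lerB_normD a (t d); lra.
have at0 : a + t d != 0 by rewrite -normr_gt0 (lt_le_trans _ atd) ?divr_gt0.
have -> : (a + t d)^-1 - a^-1 + t d / a ^+ 2 = t d ^+ 2 / (a ^+ 2 * (a + t d)).
  by field; rewrite a0 at0.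
rewrite normrM normrX normfV [X in _ / X]normrM normrX.
have tK : `|t d| ^+ 2 <= K ^+ 2 * `|d| ^+ 2.
  rewrite -exprMn lerXn2r ?nnegrE ?mulr_ge0 //.
  by rewrite -[`|d|]expr1; near: d.
have -> : 2 * K ^+ 2 / `|a| ^+ 3 * `|d| ^+ 2 =
   K ^+ 2 * `|d| ^+ 2 * (`|a| ^+ 2 * (`|a| / 2))^-1.
  by field; rewrite normr_eq0.
rewrite ler_pM ?invr_ge0 ?mulr_ge0 ?exprn_ge0 // lef_pV2 ?posrE.
- by rewrite ler_wpM2l ?exprn_ge0.
- by rewrite mulr_gt0 ?exprn_gt0 ?normr_gt0.
- by rewrite mulr_gt0 ?exprn_gt0 ?divr_gt0.
Unshelve. all: by end_near. Qed.

(** A factor vanishing at the origin eventually contracts by one half, uniformly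
    in the matrices it multiplies. *)
Lemma ord1_near_contract n (G : V -> 'M[R]_n) : ord 1 G ->
  \forall d \near (0 : V), forall p (Z : 'M[R]_(p, n)), `|Z *m G d| <= `|Z| / 2.
Proof.
move=> G1; have e0 : 0 < (2 * n.+1%:R)^-1 :> R by rewrite invr_gt0 mulr_gt0.
near=> d => p Z; apply: (le_trans (mx_norm_mul _ _)).
have Gd : `|G d| <= (2 * n.+1%:R)^-1 by near: d; exact: ord1_near_le.
apply: (@le_trans _ _ (n%:R * (`|Z| * (2 * n.+1%:R)^-1))).
  by rewrite ler_wpM2l // ler_wpM2l.
have n1 : n.+1%:R != 0 :> R by [].
have -> : n%:R * (`|Z| * (2 * n.+1%:R)^-1) = `|Z| / 2 * (n%:R / n.+1%:R).
  by field.
by rewrite ler_piMr ?divr_ge0 // ler_pdivrMr // mul1r ler_nat.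
Unshelve. all: by end_near. Qed.

(** Near an invertible matrix, matrices are invertible and their inverses stay
    bounded. *)
Lemma near_unitmx n (A : 'M[R]_n) (E : V -> 'M[R]_n) :
  A \in unitmx -> ord 1 E -> \forall d \near (0 : V), A + E d \in unitmx.
Proof.
move=> Au E1; have G := ord1_near_contract (ord_mulr (invmx A) E1).
near=> d; rewrite -row_free_unit; apply: inj_row_free => z.
rewrite mulmxDr => /eqP; rewrite addr_eq0 => /eqP zA.
have zE : z = - (z *m (E d *m invmx A)).
  by rewrite mulmxA -mulNmx -zA mulmxK.
have : `|z *m (E d *m invmx A)| <= `|z| / 2 by apply: (near G d).
rewrite -[X in X <= _]normrN -zE => zle; apply/eqP; rewrite -normr_eq0.
by have := normr_ge0 z; lra.
Unshelve. all: by end_near. Qed.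

Lemma ord_invmx n (A : 'M[R]_n) (E : V -> 'M[R]_n) :
  A \in unitmx -> ord 1 E -> ord 0 (fun d => invmx (A + E d)).
Proof.
move=> Au E1; have G := ord1_near_contract (ord_mulr (invmx A) E1).
exists (2 * `|invmx A|); first by rewrite mulr_ge0.
near=> d; rewrite expr0 mulr1; set X := invmx _.
have AEu : A + E d \in unitmx by near: d; exact: near_unitmx.
have XE : X = invmx A - X *m (E d *m invmx A).
  have XA : X *m (A + E d) *m invmx A = invmx A by rewrite mulVmx // mul1mx.
  by rewrite -{1}XA mulmxDr mulmxDl mulmxK // !mulmxA addrK.
have : `|X| <= `|invmx A| + `|X| / 2.
  by rewrite {1}XE (le_trans (ler_normB _ _)) // lerD2l; apply: (near G d).
by lra.
Unshelve. all: by end_near. Qed.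

End Order.

(** * First-order expansion of the Tikhonov solution *)

Section TikhonovExpansion.
Context {R : realType} {V : normedModType R}.

(** The derivative at [C, b] of the Tikhonov solution, in the direction
    [dC, db]. *)
Definition dtiksol m n p (lambda : R) (L : 'M[R]_(p, n)) (C : 'M[R]_(m, n))
    (b : 'cV[R]_m) (dC : 'M[R]_(m, n)) (db : 'cV[R]_m) : 'cV[R]_n :=
  let x := tiksol lambda L C b in
  tikP lambda L C *m (dC^T *m (b - C *m x) - C^T *m (dC *m x) + C^T *m db).

(** The residual of the perturbed normal equations at the unperturbed
    solution. *)
Lemma tik_residual m n p (lambda : R) (L : 'M[R]_(p, n)) (C dC : 'M[R]_(m, n))
    (b db : 'cV[R]_m) :
  let A := C^T *m C + lambda ^+ 2 *: (L^T *m L) in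
  let A' := (C + dC)^T *m (C + dC) + lambda ^+ 2 *: (L^T *m L) in
  let x := tiksol lambda L C b in
  A \in unitmx ->
  (C + dC)^T *m (b + db) - A' *m x
  = dC^T *m (b - C *m x) - C^T *m (dC *m x) + C^T *m db
    + (dC^T *m db - dC^T *m (dC *m x)).
Proof.
move=> A A' x Au.
have Ax : lambda ^+ 2 *: (L^T *m L) *m x = C^T *m b - C^T *m (C *m x).
  apply/eqP; rewrite eq_sym subr_eq addrC mulmxA -mulmxDl -/A.
  by rewrite /x /tiksol /tikP -/A -(mulmxA _ C^T b) mulKVmx.
rewrite /A' mulmxDl Ax [(C + dC)^T]raddfD /=.
rewrite !(mulmxDl, mulmxDr, mulmxN, mulNmx) !mulmxA.
by apply/colP => i; rewrite !mxE; ring.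
Qed.

Lemma ord_tiksol m n p (lambda : R) (L : 'M[R]_(p, n)) (C : 'M[R]_(m, n))
    (b : 'cV[R]_m) (dC lC : V -> 'M[R]_(m, n)) (db : V -> 'cV[R]_m) :
  C^T *m C + lambda ^+ 2 *: (L^T *m L) \in unitmx ->
  ord 1 dC -> ord 2 (fun d => dC d - lC d) -> ord 1 db ->
  ord 2 (fun d => tiksol lambda L (C + dC d) (b + db d) - tiksol lambda L C b
                  - dtiksol lambda L C b (lC d) (db d)).
Proof.
set A := C^T *m C + _ => Au dC1 dC2 db1; set x := tiksol lambda L C b.
have dCt := ord_tr dC1.
pose E d := C^T *m dC d + (dC d)^T *m C + (dC d)^T *m dC d.
have E1 : ord 1 E.
  apply: ordD; first by apply: ordD; [exact: ord_mull|exact: ord_mulr].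
  by apply: (@ordW _ _ _ _ 2) => //; exact: (ord_mul dCt dC1).
have AE d : (C + dC d)^T *m (C + dC d) + lambda ^+ 2 *: (L^T *m L) = A + E d.
  rewrite [(C + dC d)^T]raddfD /= mulmxDl !mulmxDr /A /E.
  by apply/matrixP => i j; rewrite !mxE; ring.
pose h1 d := (dC d)^T *m (b - C *m x) - C^T *m (dC d *m x) + C^T *m db d.
pose h2 d := (dC d)^T *m db d - (dC d)^T *m (dC d *m x).
pose y d := tiksol lambda L (C + dC d) (b + db d) - x.
have h1o : ord 1 h1.
  apply: ordD; last exact: ord_mull.
  apply: ordB; first exact: ord_mulr.
  by apply: ord_mull; exact: ord_mulr.
have h2o : ord 2 h2.
  apply: ordB; first exact: (ord_mul dCt db1).
  by apply: (ord_mul dCt); exact: ord_mulr.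
have yE : \forall d \near (0 : V), invmx (A + E d) *m (h1 d + h2 d) = y d.
  near=> d; have AEu : A + E d \in unitmx by near: d; exact: near_unitmx.
  rewrite /h1 /h2 /x -tik_residual // mulmxBr AE mulKmx // mulmxA.
  by rewrite /y /tiksol /tikP AE.
have y1 : ord 1 y.
  apply: (ord_near yE); apply: (ord_mul (ord_invmx Au E1)).
  by apply: ordD => //; exact: ordW h2o.
pose P := tikP lambda L C.
apply: (@ord_near _ _ _ _ (fun d => P *m h2 d - P *m (E d *m y d)
    + P *m ((dC d - lC d)^T *m (b - C *m x) - C^T *m ((dC d - lC d) *m x)))).
  near=> d; have AEu : A + E d \in unitmx by near: d; exact: near_unitmx.
  have yd : invmx (A + E d) *m (h1 d + h2 d) = y d by near: d.
  have Ay : A *m y d = h1 d + h2 d - E d *m y d.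
    by apply/eqP; rewrite eq_sym subr_eq -mulmxDl -yd mulKVmx.
  rewrite -/(y d) -[in RHS](mulKmx Au (y d)) Ay /dtiksol -/x -/P -[invmx A]/P.
  rewrite -!mulmxBr -mulmxDr; congr (_ *m _).
  rewrite /h1 [(dC d - lC d)^T]raddfB /= !(mulmxBl, mulmxBr).
  by apply/colP => i; rewrite !mxE; ring.
apply: ordD.
  by apply: ordB; apply: ord_mull => //; exact: (ord_mul E1 y1).
apply: ord_mull; apply: ordB; first by apply: ord_mulr; exact: ord_tr.
by apply: ord_mull; exact: ord_mulr.
Unshelve. all: by end_near. Qed.

End TikhonovExpansion.

(** * Cauchy matrices *)

Section CauchyExpansion.
Context {R : realType}.

(** The derivative of [cauchy_mx] at [w] in the direction [dw]. *)
Definition dcauchy_mx m n (w dw : 'cV[R]_(m + n)) : 'M[R]_(m, n) :=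
  cauchy_sq_mx w *m Diag (dsubmx dw) - Diag (usubmx dw) *m cauchy_sq_mx w.

Lemma Diag_mulr p q (A : 'M[R]_(p, q)) (d : 'cV[R]_q) :
  forall i j, (A *m Diag d) i j = A i j * d j 0.
Proof. by move=> i j; rewrite /Diag mul_mx_diag !mxE. Qed.

Lemma Diag_mull p q (A : 'M[R]_(p, q)) (d : 'cV[R]_p) :
  forall i j, (Diag d *m A) i j = d i 0 * A i j.
Proof. by move=> i j; rewrite /Diag mul_diag_mx !mxE. Qed.

Lemma Diag_mulC k (d e : 'cV[R]_k) : Diag d *m e = Diag e *m d.
Proof. by apply/colP => i; rewrite !Diag_mull mulrC. Qed.

Lemma Diag_tr k (d : 'cV[R]_k) : (Diag d)^T = Diag d.
Proof. by rewrite /Diag tr_diag_mx. Qed.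

Lemma dcauchy_mxE m n (w dw : 'cV[R]_(m + n)) i j :
  dcauchy_mx w dw i j = - ((usubmx dw i 0 - dsubmx dw j 0)
                           / (usubmx w i 0 - dsubmx w j 0) ^+ 2).
Proof. by rewrite mxE [X in _ + X]mxE Diag_mulr Diag_mull !mxE; ring. Qed.

Lemma ord_cauchy_mx (V : normedModType R) m n (w : 'cV[R]_(m + n))
    (dw : V -> 'cV[R]_(m + n)) :
  (forall i j, usubmx w i 0 != dsubmx w j 0) -> ord 1 dw ->
  ord 2 (fun d => cauchy_mx (w + dw d) - cauchy_mx w - dcauchy_mx w (dw d)).
Proof.
move=> uv dw1; apply: ord_mx => i j.
pose t d := usubmx (dw d) i 0 - dsubmx (dw d) j 0.
have entry k : ord 1 (fun d => dw d k 0).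
  have [K K0 dwK] := dw1; exists K => //; near=> d.
  by apply: le_trans (mx_norm_ge (dw d) k 0) _; near: d.
have t1 : ord 1 t.
  by apply: ordB; under eq_fun do rewrite mxE; exact: entry.
have := @ord_inv R V (usubmx w i 0 - dsubmx w j 0) t.
rewrite subr_eq0 => /(_ (uv i j) t1) o2; apply: ord_near o2.
near=> d; move: (dcauchy_mxE w (dw d) i j); move: (dcauchy_mx _ _) => D DE.
rewrite !mxE DE opprK /t !mxE.
by congr (_^-1 - _ + _); ring.
Unshelve. all: by end_near. Qed.

Lemma ord_dcauchy_mx (V : normedModType R) m n (w : 'cV[R]_(m + n))
    (dw : V -> 'cV[R]_(m + n)) :
  ord 1 dw -> ord 1 (fun d => dcauchy_mx w (dw d)).
Proof.
move=> [K K0 dwK]; apply: ord_mx => i j.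
set a := usubmx w i 0 - dsubmx w j 0.
exists (2 * K / `|a ^+ 2|); first by rewrite divr_ge0 ?mulr_ge0.
near=> d; rewrite dcauchy_mxE -/a normrN normrM normfV mulrAC.
rewrite ler_wpM2r ?invr_ge0 // !mxE (le_trans (ler_normB _ _)) //.
rewrite -mulrA mulr_natl mulr2n lerD //.
  by apply: le_trans (mx_norm_ge (dw d) _ 0) _; near: d.
by apply: le_trans (mx_norm_ge (dw d) _ 0) _; near: d.
Unshelve. all: by end_near. Qed.

(** Composing the two derivatives produces the matrices [Cu] and [Cv]. *)
Lemma dtiksol_dcauchy m n p (lambda : R) (L : 'M[R]_(p, n))
    (w dw : 'cV[R]_(m + n)) (b db : 'cV[R]_m) :
  dtiksol lambda L (cauchy_mx w) b (dcauchy_mx w dw) db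
  = tikP lambda L (cauchy_mx w)
    *m ((cauchy_mx w)^T *m db - Cu lambda L w b *m usubmx dw
        - Cv lambda L w b *m dsubmx dw).
Proof.
rewrite /dtiksol /Cu /Cv /=; set x := tiksol _ _ _ _; set r := b - _.
clearbody r x; congr (_ *m _); rewrite /dcauchy_mx.
rewrite [(_ - _)^T]raddfB /= !trmx_mul !Diag_tr !(mulmxBl, mulmxBr).
rewrite -!mulmxA (Diag_mulC (dsubmx dw) (_ *m r)) (Diag_mulC (usubmx dw) r).
rewrite (Diag_mulC (dsubmx dw) x) (Diag_mulC (usubmx dw) (_ *m x)).
move: (Diag _ *m dsubmx dw) (_ *m (Diag r *m _)) (_ *m db) => a1 a2 a3.
move: (_ *m _) (_ *m _) => a4 a5.
by apply/colP => i; rewrite !mxE; ring.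
Qed.

End CauchyExpansion.

(** * Suprema of rescaled increments *)

Section ScaledSupremum.
Context {R : realType}.

(** Let [D] agree with [F] to second order at the origin. If on the sets
    [B eps], which shrink linearly with [eps], the supremum of [N (D d) / eps]
    is [T] for each [eps], then the supremum of [N (F d) / eps] tends to [T].
    The supremum [T] need not be attained, but the near-maximizers must have the
    form [eps *: d1] with [d1] independent of [eps]. *)
Lemma cvg_ereal_sup_scaled (V : normedModType R) (W : normedZmodType R)
    (F D : V -> W) (N : W -> R) (B : R -> set V) (T H beta : R) :
  ord 2 (fun d => F d - D d) -> 0 <= H -> 0 <= beta ->
  (forall y z, N y <= N z + H * `|y - z|) ->
  (forall eps d, 0 < eps -> B eps d -> `|d| <= beta * eps) ->
  (forall eps d, 0 < eps -> B eps d -> N (D d) <= T * eps) ->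
  (forall e, 0 < e -> exists d1 : V, forall eps, 0 < eps ->
     B eps (eps *: d1) /\ (T - e) * eps <= N (D (eps *: d1))) ->
  ereal_sup [set (N (F d) / eps)%:E | d in B eps] @[eps --> 0^'+] --> T%:E.
Proof.
move=> [K K0 /nbhs_norm0P[/= delta delta0 FD]] H0 beta0 Nlip Bbd ub lb.
pose c := H * (K * beta ^+ 2); have c0 : 0 <= c by rewrite !mulr_ge0 ?exprn_ge0.
have FDle eps d : 0 < eps -> beta * eps < delta -> B eps d ->
    H * `|F d - D d| <= c * eps ^+ 2.
  move=> eps0 small Bd; have dle := Bbd _ _ eps0 Bd.
  have -> : c * eps ^+ 2 = H * (K * (beta * eps) ^+ 2) by rewrite /c; ring.
  rewrite ler_wpM2l // (le_trans (FD d (le_lt_trans dle small))) //.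
  by rewrite ler_wpM2l // lerXn2r ?nnegrE ?mulr_ge0 // ltW.
have main e : 0 < e -> \forall eps \near 0^'+,
    ((T - e)%:E <= ereal_sup [set (N (F d) / eps)%:E | d in B eps]
       <= (T + e)%:E)%E.
  move=> e0; have e20 : 0 < e / 2 by rewrite divr_gt0.
  have [d1 d1P] := lb _ e20.
  near=> eps.
  have eps0 : 0 < eps by near: eps; exact: nbhs_right_gt.
  have small : beta * eps < delta.
    apply: (@le_lt_trans _ _ ((beta + 1) * eps)).
      by rewrite ler_pM2r // lerDl.
    rewrite mulrC -ltr_pdivlMr ?ltr_wpDl //; near: eps; apply: nbhs_right_lt.
    by rewrite divr_gt0 // ltr_wpDl.
  have ceps : c * eps <= e / 2.
    apply: (@le_trans _ _ ((c + 1) * eps)).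
      by rewrite ler_pM2r // lerDl.
    rewrite mulrC -ler_pdivlMr ?ltr_wpDl //; near: eps; apply: nbhs_right_le.
    by rewrite divr_gt0 // ltr_wpDl.
  have ceps2 : c * eps ^+ 2 <= e / 2 * eps by rewrite expr2 mulrA ler_pM2r.
  apply/andP; split.
    have [Bd1 Td1] := d1P _ eps0.
    apply: le_trans (ereal_sup_ubound _); last by exists (eps *: d1).
    rewrite lee_fin ler_pdivlMr //.
    have := Nlip (D (eps *: d1)) (F (eps *: d1)); rewrite distrC.
    by have := FDle _ _ eps0 small Bd1; lra.
  apply: ge_ereal_sup => _ [d Bd <-]; rewrite lee_fin ler_pdivrMr //.
  have := Nlip (F d) (D d); have := ub _ _ eps0 Bd.
  by have := FDle _ _ eps0 small Bd; nra.
apply/fine_cvgP; split.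
  near=> eps.
  have /andP[lo hi] : ((T - 1)%:E
      <= ereal_sup [set (N (F d) / eps)%:E | d in B eps] <= (T + 1)%:E)%E.
    by near: eps; exact: main.
  by rewrite fin_numElt (lt_le_trans _ lo) ?ltNyr // (le_lt_trans hi) ?ltry.
apply/cvgrPdist_le => e e0; near=> eps.
have : ((T - e)%:E <= ereal_sup [set (N (F d) / eps)%:E | d in B eps]
       <= (T + e)%:E)%E by near: eps; exact: main.
rewrite /=; case: ereal_sup => [s||].
- by rewrite !lee_fin distrC ler_distl.
- by rewrite leye_eq andbF.
- by rewrite leeNy_eq.
Unshelve. all: by end_near. Qed.

End ScaledSupremum.

(** * The Euclidean norm and the spectral norm *)

Section Norm2.
Context {R : realType}.

Lemma norm2_ge0 k (x : 'cV[R]_k) : 0 <= norm2 x.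
Proof. exact: sqrtr_ge0. Qed.

Lemma norm2_sum k (x : 'cV[R]_k) : norm2 x ^+ 2 = \sum_i x i 0 ^+ 2.
Proof. by rewrite sqr_sqrtr // sumr_ge0 // => i _; rewrite sqr_ge0. Qed.

Lemma norm2Z k (a : R) (x : 'cV[R]_k) : norm2 (a *: x) = `|a| * norm2 x.
Proof.
rewrite /norm2 -sqrtr_sqr -sqrtrM ?sqr_ge0 // mulr_sumr.
by congr Num.sqrt; apply: eq_bigr => i _; rewrite mxE exprMn.
Qed.

Lemma norm2_0 k : norm2 (0 : 'cV[R]_k) = 0.
Proof. by rewrite -(scale0r (0 : 'cV[R]_k)) norm2Z normr0 mul0r. Qed.

Lemma norm2_neq0 k (x : 'cV[R]_k) : x != 0 -> 0 < norm2 x.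
Proof.
move=> x0; rewrite lt_neqAle norm2_ge0 andbT eq_sym.
apply: contra x0 => /eqP x0.
by apply/eqP/norm2_eq0; rewrite x0 expr0n.
Qed.

Lemma norm2_entry k (x : 'cV[R]_k) i j : `|x i j| <= norm2 x.
Proof.
rewrite ord1 -sqrtr_sqr ler_wsqrtr //.
by rewrite (bigD1 i) //= lerDl sumr_ge0 // => ? _; rewrite sqr_ge0.
Qed.

Lemma norm2_le_mx_norm k (x : 'cV[R]_k) : norm2 x <= k%:R * `|x|.
Proof.
rewrite -(@ler_pXn2r _ 2) ?nnegrE ?norm2_ge0 ?mulr_ge0 // norm2_sum.
apply: (@le_trans _ _ (k%:R * `|x| ^+ 2)).
  have -> : k%:R * `|x| ^+ 2 = \sum_(i < k) `|x| ^+ 2.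
    by rewrite sumr_const card_ord mulr_natl.
  apply: ler_sum => i _.
  by rewrite -real_normK ?num_real // lerXn2r ?nnegrE // mx_norm_ge.
rewrite exprMn ler_wpM2r ?exprn_ge0 // -natrX ler_nat.
by case: k {x} => // k; rewrite expnS leq_pmulr.
Qed.

Lemma norm2D k (x y : 'cV[R]_k) : norm2 (x + y) <= norm2 x + norm2 y.
Proof.
have [->|/norm2_neq0 x0] := eqVneq x 0; first by rewrite norm2_0 !add0r.
have [->|/norm2_neq0 y0] := eqVneq y 0; first by rewrite norm2_0 !addr0.
rewrite -(@ler_pXn2r _ 2) ?nnegrE ?addr_ge0 ?norm2_ge0 //.
rewrite norm2_sum; have := norm2_sum x; have := norm2_sum y.
move: (norm2 x) (norm2 y) x0 y0 => a c a0 c0 cE aE.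
(* Cauchy-Schwarz, from the square of the difference of the rescaled vectors. *)
have : 0 <= \sum_i (c * x i 0 - a * y i 0) ^+ 2.
  by apply: sumr_ge0 => i _; rewrite sqr_ge0.
have -> : \sum_i (c * x i 0 - a * y i 0) ^+ 2
    = 2 * (c * a) * (c * a - \sum_i x i 0 * y i 0).
  transitivity (c ^+ 2 * a ^+ 2 + a ^+ 2 * c ^+ 2
                - 2 * (c * a) * \sum_i x i 0 * y i 0).
    rewrite {1}aE {2}cE !mulr_sumr -big_split -sumrB /=.
    by apply: eq_bigr => i _; ring.
  by ring.
rewrite pmulr_rge0 ?mulr_gt0 // subr_ge0 => cs.
have -> : \sum_i (x + y) i 0 ^+ 2 = a ^+ 2 + c ^+ 2 + 2 * \sum_i x i 0 * y i 0.
  rewrite aE cE mulr_sumr -!big_split /=.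
  by apply: eq_bigr => i _; rewrite mxE; ring.
have -> : (a + c) ^+ 2 = a ^+ 2 + c ^+ 2 + 2 * (c * a) by ring.
by lra.
Qed.

Lemma norm2_lipschitz k (y z : 'cV[R]_k) :
  norm2 y <= norm2 z + k%:R * `|y - z|.
Proof.
rewrite -{1}(subrKC z y) (le_trans (norm2D _ _)) // lerD2l.
exact: norm2_le_mx_norm.
Qed.

Lemma norm2_col_mx k1 k2 (x : 'cV[R]_k1) (y : 'cV[R]_k2) :
  norm2 (col_mx x y) ^+ 2 = norm2 x ^+ 2 + norm2 y ^+ 2.
Proof.
rewrite !norm2_sum big_split_ord /=.
by congr (_ + _); apply: eq_bigr => i _; rewrite (col_mxEu, col_mxEd).
Qed.

Lemma has_sup_spectral k q (A : 'M[R]_(k, q)) :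
  has_sup [set norm2 (A *m x) | x in [set x : 'cV[R]_q | norm2 x <= 1]].
Proof.
split; first by exists (norm2 (A *m 0)); exists 0; rewrite //= norm2_0.
exists (k%:R * (q%:R * `|A|)) => _ [x /= x1 <-].
rewrite (le_trans (norm2_le_mx_norm _)) // ler_wpM2l //.
rewrite (le_trans (mx_norm_mul _ _)) // ler_wpM2l // ler_piMr //.
by apply: mx_norm_le => // i j; exact: le_trans (norm2_entry _ _ _) x1.
Qed.

Lemma spectral_norm_ge0 k q (A : 'M[R]_(k, q)) : 0 <= spectral_norm A.
Proof.
apply: ub_le_sup; first exact: (has_sup_spectral A).2.
by exists 0; rewrite /= ?mulmx0 norm2_0.
Qed.

Lemma norm2_mul_le k q (A : 'M[R]_(k, q)) (x : 'cV[R]_q) :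
  norm2 (A *m x) <= spectral_norm A * norm2 x.
Proof.
have [->|/norm2_neq0 x0] := eqVneq x 0; first by rewrite mulmx0 !norm2_0 mulr0.
rewrite -ler_pdivrMr //; apply: ub_le_sup; first exact: (has_sup_spectral A).2.
exists ((norm2 x)^-1 *: x) => /=.
  by rewrite norm2Z gtr0_norm ?invr_gt0 // mulVf // gt_eqF.
by rewrite -scalemxAr norm2Z gtr0_norm ?invr_gt0 // mulrC.
Qed.

Lemma spectral_norm_adherent k q (A : 'M[R]_(k, q)) (e : R) : 0 < e ->
  exists2 x : 'cV[R]_q, norm2 x <= 1 & spectral_norm A - e < norm2 (A *m x).
Proof.
move=> e0; have [_ [x x1 <-] ?] := sup_adherent e0 (has_sup_spectral A).
by exists x.
Qed.

Lemma spectral_norm_oppl k q1 q2 (A : 'M[R]_(k, q1)) (B : 'M[R]_(k, q2)) :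
  spectral_norm (row_mx (- A) B) = spectral_norm (row_mx A B).
Proof.
have sub (A' : 'M[R]_(k, q1)) :
    [set norm2 (row_mx (- A') B *m x)
       | x in [set x : 'cV[R]_(q1 + q2) | norm2 x <= 1]]
    `<=` [set norm2 (row_mx A' B *m x)
            | x in [set x : 'cV[R]_(q1 + q2) | norm2 x <= 1]].
  move=> _ [x /= x1 <-]; exists (col_mx (- usubmx x) (dsubmx x)).
    rewrite /= -(@ler_pXn2r _ 2) ?nnegrE ?norm2_ge0 // norm2_col_mx.
    rewrite -scaleN1r norm2Z normrN1 mul1r -norm2_col_mx vsubmxK.
    by rewrite lerXn2r ?nnegrE ?norm2_ge0.
  by rewrite -{3}(vsubmxK x) !mul_row_col mulNmx mulmxN.
congr sup; apply/seteqP; split; first exact: sub.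
by have := sub (- A); rewrite opprK.
Qed.

End Norm2.

(** * Structured perturbations *)

Section Componentwise.
Context {R : realType}.

Lemma componentwise_le l N (J : 'M[R]_(l, N)) (z h : 'cV[R]_N) (eps : R) i :
  (forall j, `|h j 0| <= eps * `|z j 0|) ->
  `|(J *m h) i 0| <= eps * (absmx J *m absmx z) i 0.
Proof.
move=> hz; rewrite !mxE (le_trans (ler_norm_sum _ _ _)) // mulr_sumr.
apply: ler_sum => j _; rewrite !mxE normrM mulrCA.
by rewrite ler_wpM2l.
Qed.

(** Each component of the bound is attained, at the vector whose signs match
    those of the corresponding row. *)
Lemma componentwise_attained l N (J : 'M[R]_(l, N)) (z : 'cV[R]_N) i :
  exists2 h : 'cV[R]_N, forall j, `|h j 0| <= `|z j 0|
    & (J *m h) i 0 = (absmx J *m absmx z) i 0.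
Proof.
exists (\col_j (Num.sg (J i j) * `|z j 0|)) => [j|].
  rewrite mxE normrM normr_id ler_piMl // normr_sg.
  by case: (_ != 0).
rewrite !mxE; apply: eq_bigr => j _; rewrite !mxE mulrA.
by congr (_ * _); rewrite mulrC -normrEsg.
Qed.

End Componentwise.

Section CauchyPerturbation.
Context {R : realType} (m n p l : nat) (lambda : R) (L : 'M[R]_(p, n))
  (M : 'M[R]_(l, n)) (w : 'cV[R]_(m + n)) (b : 'cV[R]_m).

Let P := tikP lambda L (cauchy_mx w).

(** The Jacobian matrix at [[w; b]] of [M] times the Tikhonov solution. *)
Definition cauchy_jacobian : 'M[R]_(l, m + n + m) :=
  row_mx (row_mx (- (M *m P *m Cu lambda L w b))
                 (- (M *m P *m Cv lambda L w b)))
         (M *m P *m (cauchy_mx w)^T).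

Lemma cauchy_jacobian_abs :
  absmx cauchy_jacobian *m absmx (col_mx w b)
  = absmx (M *m P *m Cu lambda L w b) *m absmx (usubmx w)
    + absmx (M *m P *m Cv lambda L w b) *m absmx (dsubmx w)
    + absmx (M *m P *m (cauchy_mx w)^T) *m absmx b.
Proof.
have absN q1 q2 (A : 'M[R]_(q1, q2)) : absmx (- A) = absmx A.
  by apply/matrixP => i j; rewrite !mxE normrN.
have abs_row k q1 q2 (A : 'M[R]_(k, q1)) (B : 'M[R]_(k, q2)) :
  absmx (row_mx A B) = row_mx (absmx A) (absmx B) by exact: map_row_mx.
have abs_col k1 k2 (y : 'cV[R]_k1) (z : 'cV[R]_k2) :
  absmx (col_mx y z) = col_mx (absmx y) (absmx z) by exact: map_col_mx.
rewrite /cauchy_jacobian !abs_row !absN abs_col mul_row_col; congr (_ + _).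
by rewrite -[in X in _ *m absmx X = _](vsubmxK w) abs_col mul_row_col.
Qed.

Lemma cauchy_jacobian_spectral :
  spectral_norm cauchy_jacobian
  = spectral_norm (M *m P *m row_mx (row_mx (Cu lambda L w b)
                                            (Cv lambda L w b))
                                    (cauchy_mx w)^T).
Proof.
by rewrite !mul_mx_row /cauchy_jacobian -opp_row_mx spectral_norm_oppl.
Qed.

Lemma cauchy_jacobianE (dw : 'cV[R]_(m + n)) (db : 'cV[R]_m) :
  cauchy_jacobian *m col_mx dw db
  = M *m dtiksol lambda L (cauchy_mx w) b (dcauchy_mx w dw) db.
Proof.
rewrite dtiksol_dcauchy -/P -{1}(vsubmxK dw) /cauchy_jacobian !mul_row_col.
move: (Cu lambda L w b) (Cv lambda L w b) => U U'.
by rewrite !mulmxBr !mulNmx !mulmxA addrC addrA.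
Qed.

Context (lambda_gt0 : 0 < lambda) (rk : \rank (col_mx (cauchy_mx w) L) = n)
  (uv : forall i j, usubmx w i 0 != dsubmx w j 0).

Lemma ord_cauchy_deltax :
  ord 2 (fun d : 'cV[R]_(m + n) * 'cV[R]_m =>
    M *m deltax lambda L w b d.1 d.2 - cauchy_jacobian *m col_mx d.1 d.2).
Proof.
have fst1 : ord 1 (fun d : 'cV[R]_(m + n) * 'cV[R]_m => d.1).
  by exists 1 => //; near=> d; rewrite mul1r expr1 prod_normE le_max lexx.
have snd1 : ord 1 (fun d : 'cV[R]_(m + n) * 'cV[R]_m => d.2).
  by exists 1 => //; near=> d; rewrite mul1r expr1 prod_normE le_max lexx orbT.
have dC2 := ord_cauchy_mx uv fst1.
have dC1 : ord 1 (fun d : 'cV[R]_(m + n) * 'cV[R]_m =>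
    cauchy_mx (w + d.1) - cauchy_mx w).
  apply: (@ord_near _ _ _ _ (fun d : 'cV[R]_(m + n) * 'cV[R]_m =>
    (cauchy_mx (w + d.1) - cauchy_mx w - dcauchy_mx w d.1) + dcauchy_mx w d.1)).
    by near=> d; rewrite subrK.
  by apply: ordD; [exact: ordW dC2|exact: ord_dcauchy_mx].
have := ord_mull M (ord_tiksol b (tik_unitmx lambda_gt0 rk) dC1 dC2 snd1).
by apply: ord_near; near=> d; rewrite cauchy_jacobianE mulmxBr.
Unshelve. all: by end_near. Qed.

(** The componentwise limit, for the maximum norm weighted by [a]. *)
Lemma cvg_componentwise (a : 'cV[R]_l) :
  ereal_sup [set (`|Diag a *m (M *m deltax lambda L w b d.1 d.2)| / eps)%:E
            | d in cw_perturb w b eps] @[eps --> 0^'+]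
  --> `|Diag a *m (absmx cauchy_jacobian *m absmx (col_mx w b))|%:E.
Proof.
set S := absmx _ *m _; pose z := col_mx w b.
have S0 i : 0 <= S i 0.
  by rewrite mxE sumr_ge0 // => j _; rewrite !mxE mulr_ge0.
have dwb eps (d : 'cV[R]_(m + n) * 'cV[R]_m) : cw_perturb w b eps d <->
    (forall j, `|col_mx d.1 d.2 j 0| <= eps * `|z j 0|).
  split=> [[dw db] j|h].
    case: (split_ordP j) => k ->; rewrite /z !(col_mxEu, col_mxEd).
      by have := dw k 0; rewrite !mxE.
    by have := db k 0; rewrite !mxE.
  split=> k j; rewrite (ord1 j) !mxE.
    by have := h (lshift _ k); rewrite /z !col_mxEu.
  by have := h (rshift _ k); rewrite /z !col_mxEd.
apply: (@cvg_ereal_sup_scaled _ _ _ _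
  (fun d : 'cV[R]_(m + n) * 'cV[R]_m => cauchy_jacobian *m col_mx d.1 d.2)
  (fun y => `|Diag a *m y|) _ _ (l%:R * `|Diag a|) `|z|).
- exact: ord_cauchy_deltax.
- by rewrite mulr_ge0.
- by [].
- move=> y y'; rewrite -{1}(subrKC y' y) mulmxDr (le_trans (ler_normD _ _)) //.
  by rewrite lerD2l -mulrA mx_norm_mul.
- move=> eps d eps0 /dwb h; have dz j : `|col_mx d.1 d.2 j 0| <= `|z| * eps.
    by rewrite mulrC (le_trans (h j)) // ler_wpM2l ?mx_norm_ge // ltW.
  have ze : 0 <= `|z| * eps by rewrite mulr_ge0 // ltW.
  rewrite prod_normE ge_max; apply/andP; split.
    apply: mx_norm_le => // k j; rewrite (ord1 j).
    by have := dz (lshift _ k); rewrite col_mxEu.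
  apply: mx_norm_le => // k j; rewrite (ord1 j).
  by have := dz (rshift _ k); rewrite col_mxEd.
- move=> eps d eps0 /dwb h.
  rewrite mulrC -(gtr0_norm eps0) -normrZ; apply: mx_norm_mono => i j.
  rewrite (ord1 j) scalemxAr !Diag_mull !normrM ler_wpM2l //.
  rewrite [(eps *: S) i 0]mxE normrM (gtr0_norm eps0) (ger0_norm (S0 i)).
  exact: componentwise_le.
- move=> e e0.
  have [S_eq0|S_neq0] := eqVneq (Diag a *m S) 0.
    exists 0 => eps eps0; split.
      by apply/dwb => j; rewrite scaler0 /= col_mx0 mxE normr0 mulr_ge0 // ltW.
    rewrite S_eq0 normr0 (le_trans _ (normr_ge0 _)) //.
    by rewrite sub0r mulNr oppr_le0 mulr_ge0 // ltW.
  (* The perturbation attaining a largest weighted component of S. *)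
  have [i [j]] := mx_norm_entry S_neq0; rewrite (ord1 j) => Si.
  have [h hz hS] := componentwise_attained cauchy_jacobian z i.
  exists (usubmx h, dsubmx h) => eps eps0.
  have -> : col_mx (eps *: (usubmx h, dsubmx h)).1
      (eps *: (usubmx h, dsubmx h)).2 = eps *: h by rewrite /= -scale_col_mx vsubmxK.
  split.
    apply/dwb => k; rewrite /= -scale_col_mx vsubmxK mxE normrM gtr0_norm //.
    by rewrite ler_wpM2l // ltW.
  rewrite -!scalemxAr normrZ gtr0_norm // mulrC ler_pM2l //.
   apply: (@le_trans _ _ `|Diag a *m S|); first by rewrite gerBl ltW.
  rewrite Si; apply: le_trans (mx_norm_ge _ i 0).
  by rewrite !Diag_mull hS.
Qed.

(** The normwise limit, for the Euclidean norm divided by [c]. *)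
Lemma cvg_normwise (c : R) : 0 < c ->
  ereal_sup [set (norm2 (M *m deltax lambda L w b d.1 d.2) / c / eps)%:E
            | d in nw_perturb w b eps] @[eps --> 0^'+]
  --> (spectral_norm cauchy_jacobian * norm2 (col_mx w b) / c)%:E.
Proof.
move=> c0; set rho := norm2 (col_mx w b); have rho0 : 0 <= rho := norm2_ge0 _.
apply: (@cvg_ereal_sup_scaled _ _ _ _
  (fun d : 'cV[R]_(m + n) * 'cV[R]_m => cauchy_jacobian *m col_mx d.1 d.2)
  (fun y => norm2 y / c) _ _ (l%:R / c) rho).
- exact: ord_cauchy_deltax.
- by rewrite divr_ge0 // ltW.
- by [].
- move=> y y'; rewrite mulrAC -mulrDl ler_pM2r ?invr_gt0 //.
  exact: norm2_lipschitz.
- move=> eps d eps0 Bd.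
  have dz j : `|col_mx d.1 d.2 j 0| <= rho * eps.
    by rewrite mulrC (le_trans (norm2_entry _ _ _) Bd).
  have ze : 0 <= rho * eps by rewrite mulr_ge0 // ltW.
  rewrite prod_normE ge_max; apply/andP; split.
    apply: mx_norm_le => // k j; rewrite (ord1 j).
    by have := dz (lshift _ k); rewrite col_mxEu.
  apply: mx_norm_le => // k j; rewrite (ord1 j).
  by have := dz (rshift _ k); rewrite col_mxEd.
- move=> eps d eps0 Bd; rewrite mulrAC ler_pM2r ?invr_gt0 //.
  rewrite (le_trans (norm2_mul_le _ _)) // -mulrA (mulrC rho).
  by rewrite ler_wpM2l ?spectral_norm_ge0.
- move=> e e0.
  (* The tolerance on the spectral norm is divided by rho + 1, not by rho, so
     that rho may vanish. *)
  have rho1 : 0 < rho + 1 by rewrite ltr_wpDl.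
  have e1 : 0 < e * c / (rho + 1) by rewrite divr_gt0 ?mulr_gt0.
  have [x x1 Jx] := spectral_norm_adherent cauchy_jacobian e1.
  exists (usubmx (rho *: x), dsubmx (rho *: x)) => eps eps0.
  have colE : col_mx (eps *: (usubmx (rho *: x), dsubmx (rho *: x))).1
      (eps *: (usubmx (rho *: x), dsubmx (rho *: x))).2 = eps *: (rho *: x).
    by rewrite /= -scale_col_mx vsubmxK.
  rewrite colE; split.
    rewrite /nw_perturb /= -/rho; rewrite /= in colE; rewrite colE.
    rewrite !norm2Z (gtr0_norm eps0) ler_pM2l // (ger0_norm rho0).
    by rewrite ler_piMr.
  rewrite -!scalemxAr !norm2Z (gtr0_norm eps0) (ger0_norm rho0).
  have te : rho * (e * c / (rho + 1)) <= e * c.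
    rewrite mulrCA ler_piMr ?(ltW (mulr_gt0 e0 c0)) // ler_pdivrMr // mul1r.
    by rewrite lerDl.
  have Jrho : rho * (spectral_norm cauchy_jacobian - e * c / (rho + 1))
      <= rho * norm2 (cauchy_jacobian *m x) by rewrite ler_wpM2l // ltW.
  have -> : (spectral_norm cauchy_jacobian * rho / c - e) * eps
      = eps * (spectral_norm cauchy_jacobian * rho - e * c) / c.
    by field; rewrite gt_eqF.
  rewrite ler_pM2r ?invr_gt0 // ler_pM2l //.
  by move: Jrho; rewrite mulrBr; lra.
Qed.

End CauchyPerturbation.

Theorem theorem4 (R : realType) (m n p l : nat) (lambda : R)
    (L : 'M[R]_(p, n)) (M : 'M[R]_(l, n))
    (u : 'cV[R]_m) (v : 'cV[R]_n) (b : 'cV[R]_m)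
    (w := col_mx u v) (C := cauchy_mx w)
    (P := tikP lambda L C) (x := tiksol lambda L C b)
    (S := absmx (M *m P *m Cu lambda L w b) *m absmx u
          + absmx (M *m P *m Cv lambda L w b) *m absmx v
          + absmx (M *m P *m C^T) *m absmx b) :
  0 < lambda ->
  (p <= n)%N -> (n <= m)%N -> (l <= n)%N ->
  \rank L = p ->
  \rank (col_mx C L) = n ->
  (forall i j, u i 0 != v j 0) ->
  M *m x != 0 ->
  [/\ cvg (mReg_sup lambda L M w b eps @[eps --> 0^'+]) /\
      mReg lambda L M w b = (`|S| / `|M *m x|)%:E,
      (forall i, (M *m x) i 0 != 0) ->
      cvg (cReg_sup lambda L M w b eps @[eps --> 0^'+]) /\
      cReg lambda L M w b = `|cdiv S (M *m x)|%:E
    & cvg (kappaReg_sup lambda L M w b eps @[eps --> 0^'+]) /\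
      kappaReg lambda L M w b =
        (spectral_norm (M *m P *m row_mx (row_mx (Cu lambda L w b)
                                                 (Cv lambda L w b)) C^T)
         * norm2 (col_mx w b) / norm2 (M *m x))%:E].
Proof.
move=> lambda0 _ _ _ _ rk uv Mx0.
have uvw i j : usubmx w i 0 != dsubmx w j 0 by rewrite col_mxKu col_mxKd.
have cw := @cvg_componentwise _ _ _ _ _ _ _ M _ b lambda0 rk uvw.
have nw := @cvg_normwise _ _ _ _ _ _ _ M _ b lambda0 rk uvw.
have SE : absmx (cauchy_jacobian lambda L M w b) *m absmx (col_mx w b) = S.
  by rewrite cauchy_jacobian_abs col_mxKu col_mxKd.
have limP (f g : R -> \bar R) (t : \bar R) : f =1 g ->
    g eps @[eps --> 0^'+] --> t ->
    cvg (f eps @[eps --> 0^'+]) /\ lim (f eps @[eps --> 0^'+]) = t.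
  move=> /funext -> gt; split; last exact: cvg_lim.
  by apply/cvg_ex; exists t.
split.
- pose c := `|M *m x|^-1.
  have cE (y : 'cV[R]_l) : `|Diag (const_mx c) *m y| = `|y| / `|M *m x|.
    rewrite /Diag trmx_const diag_const_mx mul_scalar_mx normrZ.
    by rewrite ger0_norm ?invr_ge0 // mulrC.
  have := cw (const_mx c); rewrite SE cE; apply: limP => eps.
  congr ereal_sup; apply: eq_imagel => d _.
  by rewrite cE invfM mulrA mulrAC.
- move=> Mxi; pose a : 'cV[R]_l := \col_i ((M *m x) i 0)^-1.
  have aE (y : 'cV[R]_l) : Diag a *m y = cdiv y (M *m x).
    by apply/colP => i; rewrite Diag_mull [a i 0]mxE [RHS]mxE mulrC.
  have := cw a; rewrite SE aE; apply: limP => eps.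
  congr ereal_sup; apply: eq_imagel => d _.
  by rewrite aE mulrC.
- have := nw _ (norm2_neq0 Mx0).
  rewrite cauchy_jacobian_spectral; apply: limP => eps.
  congr ereal_sup; apply: eq_imagel => d _.
  by rewrite invfM mulrA mulrAC.
Qed.
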